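(* Let $X$ and $Z$ be Hausdorff, locally convex topological vector spaces, let $C\subseteq Z$ be a convex, pointed cone with nonempty interior, and let $K$ be a nonempty, convex and closed subset of $X$. Let $D\subseteq K$ be a self segment-dense set in $K$ and consider a mapping $f:K\times K\to Z$ satisfying (i) for all $y\in D$, the mapping $x\mapsto f(x,y)$ is $C$-upper semicontinuous on $K$; (ii) for all $x\in K$, the mapping $y\mapsto f(x,y)$ is $C$-upper semicontinuous on $K\setminus D$; (iii) for all $x\in D$, the mapping $y\mapsto f(x,y)$ is $C$-convex on $D$; (iv) for all $x\in D$, $f(x,x)\notin -\operatorname{int} C$; (v) there exist a compact set $K_0\subseteq X$ and $y_0\in D$ such that $f(x,y_0)\in -\operatorname{int} C$ for all $x\in K\setminus K_0$. Then there exists $x_0\in K$ such that $f(x_0,y)\notin -\operatorname{int} C$ for all $y\in K$.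
   Context: All vector spaces are real. $\operatorname{int}$ denotes interior and $\operatorname{cl}$ closure. A set $C\subseteq Z$ is a cone if $tc\in C$ for all $c\in C$ and $t\ge 0$; it is convex if $C+C=C$, and pointed if $C\cap(-C)=\{0\}$. Write $z_1\le z_2$ iff $z_2-z_1\in C$. $C$-upper semicontinuity: a map $g:K\to Z$ is $C$-upper semicontinuous at $x\in K$ if for any neighborhood $V$ of $g(x)$ there exists a neighborhood $U$ of $x$ such that $g(u)\in V-C$ for all $u\in U\cap K$. It is $C$-upper semicontinuous on a subset $S\subseteq K$ if it is so, as a map on $K$, at every point of $S$. $C$-convexity: for a (not necessarily convex) set $D$, $g$ is $C$-convex on $D$ if for all $n\in\mathbb N$, $x_1,\dots,x_n\in D$ and $\lambda_1,\dots,\lambda_n\ge 0$ with $\sum_{i=1}^n\lambda_i=1$ such that $\sum_{i=1}^n\lambda_i x_i\in D$, one has $g\left(\sum_{i=1}^n\lambda_i x_i\right)\le\sum_{i=1}^n\lambda_i g(x_i)$. Self segment-dense set: let $U\subseteq V\subseteq X$ with $V$ convex. $U$ is self segment-dense in $V$ if $U$ is dense in $V$ (i.e. $V\subseteq\operatorname{cl}U$) and for all $x,y\in U$ the set $[x,y]\cap U$ is dense in $[x,y]$, where $[x,y]=\{x+t(y-x):t\in[0,1]\}$. *)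

(* Defs.v *)
From HB Require Import structures.
From mathcomp Require Import all_boot all_order all_algebra.
From mathcomp Require Import all_classical all_reals all_analysis.

Set Implicit Arguments.
Unset Strict Implicit.
Unset Printing Implicit Defensive.

Import Order.TTheory GRing.Theory Num.Theory.
Import numFieldNormedType.Exports.

Local Open Scope classical_set_scope.
Local Open Scope ring_scope.

Definition cone (R : realType) (Z : lmodType R) (C : set Z) : Prop :=
  forall (c : Z) (t : R), C c -> 0 <= t -> C (t *: c).

(* Convexity of a cone, expressed by the Minkowski sum: C + C = C. *)
Definition convex_cone (Z : zmodType) (C : set Z) : Prop :=
  [set c1 + c2 | c1 in C & c2 in C] = C.

Definition pointed_cone (Z : zmodType) (C : set Z) : Prop :=
  C `&` [set - c | c in C] = [set 0].

Definition cone_le (Z : zmodType) (C : set Z) (z1 z2 : Z) : Prop :=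
  C (z2 - z1).

Definition opp_int (R : realType) (Z : tvsType R) (C : set Z) : set Z :=
  [set - c | c in C°].

(* [g] stands for a map K -> Z: only its values on [K] are used (when [K x]). *)
Definition cone_usc_at (R : realType) (X Z : tvsType R) (C : set Z)
    (K : set X) (g : X -> Z) (x : X) : Prop :=
  forall V : set Z, nbhs (g x) V ->
    exists2 U : set X, nbhs x U &
      forall u, (U `&` K) u -> [set v - c | v in V & c in C] (g u).

(* [S] is meant to be a subset of [K]; the neighbourhoods at the points of [S]
   are relative to [K], not to [S]. *)
Definition cone_usc_on (R : realType) (X Z : tvsType R) (C : set Z)
    (K S : set X) (g : X -> Z) : Prop :=
  forall x, S x -> cone_usc_at C K g x.

(* [D] need not be convex; for n = 0 the condition is vacuous. *)
Definition cone_convex_on (R : realType) (X Z : lmodType R) (C : set Z)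
    (D : set X) (g : X -> Z) : Prop :=
  forall (n : nat) (x : 'I_n -> X) (l : 'I_n -> R),
    (forall i, D (x i)) ->
    (forall i, 0 <= l i) ->
    \sum_(i < n) l i = 1 ->
    D (\sum_(i < n) l i *: x i) ->
    cone_le C (g (\sum_(i < n) l i *: x i)) (\sum_(i < n) l i *: g (x i)).

Definition segment (R : realType) (X : lmodType R) (x y : X) : set X :=
  [set x + t *: (y - x) | t in `[0, 1]].

Definition dense_in (T : topologicalType) (U V : set T) : Prop :=
  U `<=` V /\ V `<=` closure U.

Definition self_segment_dense (R : realType) (X : tvsType R)
    (U V : set X) : Prop :=
  dense_in U V /\
  forall x y, U x -> U y -> dense_in (segment x y `&` U) (segment x y).

(* Main.v *)
(* For y in D let G(y) be the set of x in K with f(x, y) not in -int C.  By (i)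
   it is closed, by (v) G(y_0) is compact.  Self segment-density makes D dense in
   every polytope with vertices in D, so C-convexity on D and f(x, x) not in
   -int C show that co{y_i : i in I} is covered by the G(y_i), i in I.  The KKM
   theorem and compactness give a point x_0 common to all G(y), y in D; by (ii)
   and the density of D it also works for y in K \ D.

   The KKM theorem comes from Scarf's triangulation-free form of Sperner's lemma,
   applied to the integer points of a dilated simplex ordered by each coordinate:
   if no point belonged to all G(y_i), one could colour the grid points so that a
   whole ball around a point of colour i misses G(y_i); Scarf's lemma yields a
   small family of grid points and, close to all of them, a point supported on
   exactly their colours, which contradicts the covering hypothesis. *)

Require Import Defs.
From HB Require Import structures.
From mathcomp Require Import all_boot all_order all_algebra.
From mathcomp Require Import all_classical all_reals all_analysis.
From mathcomp Require Import zify.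

Set Implicit Arguments.
Unset Strict Implicit.
Unset Printing Implicit Defensive.

Import Order.TTheory GRing.Theory Num.Theory.
Import numFieldNormedType.Exports.

(** * Scarf's lemma *)

Section Combinatorics.
(* Several names of [finset] are shadowed by [classical_sets]. *)
Import all_boot.
Local Open Scope nat_scope.
Local Open Scope set_scope.

(** * Dominant sets for a family of orders, and their completions *)

Section Dominance.
Variables (I V : finType) (r : I -> V -> nat).
Hypothesis r_inj : forall i, injective (r i).

(** The condition behind Scarf's primitive sets: no vertex exceeds, in every order, some element of
    [p]. *)
Definition dominant (p : {set V}) :=
  [forall y, exists i, forall x in p, r i y <= r i x].

Lemma dominantP (p : {set V}) :
  reflect (forall y, exists i, {in p, forall x, r i y <= r i x}) (dominant p).
Proof.
apply: (iffP forallP) => H y; have := H y.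
  by case/existsP=> i /forall_inP Hi; exists i.
by case=> i Hi; apply/existsP; exists i; apply/forall_inP.
Qed.

Lemma dominantS (d p : {set V}) : d \subset p -> dominant p -> dominant d.
Proof.
move=> /subsetP dp /dominantP domp; apply/dominantP => y.
by have [i yp] := domp y; exists i => x /dp; apply: yp.
Qed.

(* Let [m l] be the [l]-least element of [d]. By dominance [m] is onto [d], so two
   orders [i <> j] share their least element. A completion [x] becomes the least
   element for [i] or for [j] only, and is then the greatest element, for that
   order, among the vertices above [m l] for all the other [l]. *)
Lemma even_completions (d : {set V}) :
  dominant d -> d != set0 -> #|d|.+1 = #|I| ->
  (forall k, exists v, forall l, l != k -> exists2 x, x \in d & r l x < r l v) ->
  ~~ odd #|[set x | (x \notin d) && dominant (x |: d)]|.
Proof.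
move=> /dominantP domd /set0Pn[z0 z0d] cardd above.
pose m l := [arg min_(x < z0 in d) r l x].
have md l : m l \in d by rewrite /m; case: arg_minnP.
have m_min l x : x \in d -> r l (m l) <= r l x.
  by rewrite /m; case: arg_minnP => // a _; apply.
have m_uniq l x : x \in d -> {in d, forall z, r l x <= r l z} -> x = m l.
  move=> xd xmin; apply: (r_inj (i := l)); apply/eqP.
  by rewrite eqn_leq xmin ?md // m_min.
have [i [j [ij mij]]] : exists i, exists j, i != j /\ m i = m j.
  have /injectivePn[i [j ij mij]] : ~~ injectiveb m.
    apply/negP => /injectiveP m_inj.
    have : #|m @: [set: I]| <= #|d|.
      by apply/subset_leq_card/subsetP => _ /imsetP[l _ ->].
    by rewrite card_imset // cardsT -cardd ltnn.
  by exists i, j.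
have m_surj k z : (k == i) || (k == j) -> z \in d -> exists2 l, l != k & z = m l.
  move=> kij zd; have [l zl] := domd z; have zE := m_uniq _ _ zd zl.
  case: (eqVneq l k) => [lk|]; last by exists l.
  case/orP: kij => /eqP kE; first by exists j; rewrite ?kE 1?eq_sym // zE lk kE.
  by exists i; rewrite ?kE // zE lk kE.
pose M k := [set y | [forall l, (l != k) ==> (r l (m l) < r l y)]].
have inM k y : reflect (forall l, l != k -> r l (m l) < r l y) (y \in M k).
  rewrite inE; apply: (iffP forallP) => H l; first by apply/implyP.
  by apply/implyP; apply: H.
have M_neq0 k : exists v, v \in M k.
  have [v vP] := above k; exists v; apply/inM => l /vP[x xd xv].
  exact: leq_ltn_trans (m_min _ _ xd) xv.
pose t k := [arg max_(x > xchoose (M_neq0 k) in M k) r k x].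
have tP k : t k \in M k /\ {in M k, forall y, r k y <= r k (t k)}.
  by rewrite /t; case: arg_maxnP => //; apply: xchooseP.
have notM x : ~ forall l, r l (m l) < r l x.
  move=> mx; have [l lP] := domd x.
  by have := lP _ (md l); rewrite leqNgt mx.
have t_new k : (k == i) || (k == j) -> t k \notin d.
  move=> kij; apply/negP => td; have [l lk tE] := m_surj _ _ kij td.
  by have /inM/(_ l lk) := (tP k).1; rewrite -tE ltnn.
(* A vertex [y] violating dominance could be below all of [d] only for the order [k]. It would then
   lie in [M k] and above [t k], against the choice of [t k]. *)
have t_dom k : dominant (t k |: d).
  apply/dominantP => y.
  case: (boolP [exists l, [forall x in t k |: d, r l y <= r l x]]) => [|no].
    by case/existsP=> l /forall_inP; exists l.
  have [l ly] := domd y.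
  have tl l' : {in d, forall x, r l' y <= r l' x} -> r l' (t k) < r l' y.
    move=> l'y; rewrite ltnNge; apply: contra no => yt; apply/existsP; exists l'.
    by apply/forall_inP => x; rewrite in_setU1 => /predU1P[->|/l'y].
  have mt := inM _ _ (tP k).1.
  have lk : l = k.
    apply/eqP; apply: contraT => /mt; rewrite ltnNge.
    by rewrite (leq_trans (ltnW (tl _ ly))) ?ly.
  subst l; have yM : y \in M k.
    apply/inM => l lk; rewrite ltnNge; apply: contra no => ym.
    apply/existsP; exists l; apply/forall_inP => x.
    have yd z : z \in d -> r l y <= r l z by move/(m_min l); apply: leq_trans.
    rewrite in_setU1 => /predU1P[->|/yd//].
    by rewrite (leq_trans ym) // ltnW // mt.
  by have := tl _ ly; rewrite ltnNge (tP k).2.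
suff -> : [set x | (x \notin d) && dominant (x |: d)] = [set t i; t j].
  rewrite cards2; case: eqVneq => // tij; exfalso.
  apply: (notM (t i)) => l; have [/inM tiM _] := tP i.
  case: (eqVneq l i) => [->|/tiM//].
  by have /inM := (tP j).1; rewrite -tij; apply.
apply/setP => x; rewrite !inE; apply/idP/idP; last first.
  by case/orP => /eqP ->; rewrite t_new ?t_dom ?eqxx ?orbT.
case/andP => xd domx.
(* [g] assigns to each member of [x |: d] an order for which it is least; it is injective there, and
   the cardinalities make it onto. *)
pose g z := xchoose (existsP (forallP domx z)).
have gP z : {in x |: d, forall y, r (g z) z <= r (g z) y}.
  exact/forall_inP/(xchooseP (existsP (forallP domx z))).
have g_inj : {in x |: d &, injective g}.
  move=> a b ad bd gab; apply: (r_inj (i := g a)); apply/eqP.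
  by rewrite eqn_leq gP // gab gP.
have g_surj l : exists2 z, z \in x |: d & l = g z.
  have : g @: (x |: d) = setT.
    apply/eqP; rewrite eqEcard subsetT card_in_imset // cardsT -cardd.
    by rewrite cardsU1 xd add1n leqnn.
  by move/setP/(_ l); rewrite inE => /imsetP[z zd ->]; exists z.
have key k : k = g x -> x = t k.
  move=> kx; have xM : x \in M k.
    apply/inM => l; have [z zd ->] := g_surj l; rewrite kx => zx.
    have {}zd : z \in d.
      by move: zd; rewrite in_setU1 => /predU1P[zx'|//]; rewrite zx' eqxx in zx.
    have -> : m (g z) = z.
      apply/esym/m_uniq => // y yd; apply: gP; exact: setU1r.
    rewrite ltn_neqAle gP ?setU11 // andbT; apply: contraNneq xd => /r_inj <- //.
  apply: (r_inj (i := k)); apply/eqP; rewrite eqn_leq (tP k).2 //=.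
  have [l lt] := elimT (dominantP _) domx (t k).
  case: (eqVneq l k) lt => [->|lk] lt; first by rewrite lt ?setU11.
  have /inM/(_ l lk) := (tP k).1.
  by rewrite ltnNge lt // setU1r.
(* If [g x] is neither [i] nor [j], these orders are assigned to [m i] and [m j], which coincide, so
   that [i = j]. *)
have [zi zid gi] := g_surj i; have [zj zjd gj] := g_surj j.
have [zix|zix] := eqVneq zi x; first by rewrite -(key i) ?eqxx // gi zix.
have [zjx|zjx] := eqVneq zj x; first by rewrite -(key j) ?eqxx ?orbT // gj zjx.
have zE l z : z \in x |: d -> z != x -> l = g z -> z = m l.
  move=> zd zx ->; move: zd; rewrite in_setU1 (negPf zx) /= => zd.
  by apply: m_uniq => // y yd; apply: gP; exact: setU1r.
case/eqP: ij; rewrite gi gj; congr g.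
by rewrite (zE _ _ zid zix gi) (zE _ _ zjd zjx gj).
Qed.

End Dominance.

(* If one facet of [p] has all colours but [i], the removed vertex [x] shares its
   colour with a unique other vertex [x'], and [x], [x'] are interchangeable. *)
Lemma even_facets (I V : finType) (c : V -> I) (i : I) (p : {set V}) :
  #|p| = #|I| -> c @: p != setT ->
  ~~ odd #|[set x in p | c @: (p :\ x) == ~: [set i]]|.
Proof.
move=> cardp cp.
case: (set_0Vmem [set x in p | c @: (p :\ x) == ~: [set i]]) => [->|[x]].
  by rewrite cards0.
rewrite inE => /andP[xp /eqP cx].
have facet_inj z : z \in p -> c @: (p :\ z) = ~: [set i] -> {in p :\ z &, injective c}.
  move=> zp cz; apply/imset_injP; rewrite cz.
  by have := cardsC1 i; have := cardsD1 z p; rewrite zp cardp; lia.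
have split z : z \in p -> c @: p = c z |: c @: (p :\ z).
  by move=> zp; rewrite -imsetU1 setD1K.
have : c x \in c @: (p :\ x).
  rewrite cx !inE; apply: contra cp => /eqP cxi.
  by rewrite (split x) // cx cxi setUCr.
case/imsetP => x' x'p cxx'; have /setD1P[x'x x'p'] := x'p.
suff -> : [set x in p | c @: (p :\ x) == ~: [set i]] = [set x; x'].
  by rewrite cards2 eq_sym x'x.
apply/setP => z; rewrite !inE; apply/idP/idP.
  case/andP=> zp /eqP cz; apply: contraT; rewrite negb_or => /andP[zx zx'].
  case/eqP: x'x; apply/esym; apply: (facet_inj _ zp cz) => //;
    by rewrite !inE 1?eq_sym ?zx ?zx'.
case/orP=> /eqP ->; first by rewrite xp cx eqxx.
have px' : p :\ x' = x |: p :\ x :\ x'.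
  apply/setP => a; rewrite !inE; case: (eqVneq a x) => [->|] //=.
  by rewrite xp eq_sym x'x.
have px : p :\ x = x' |: p :\ x :\ x'.
  apply/setP => a; rewrite !inE; case: (eqVneq a x') => [->|] //=.
  by rewrite x'p' x'x.
by rewrite x'p' -cx px' [in X in _ == X]px !imsetU1 cxx' eqxx.
Qed.

Lemma even_sum (J : finType) (P : pred J) (F : J -> nat) :
  (forall j, P j -> ~~ odd (F j)) -> ~~ odd (\sum_(j | P j) F j).
Proof.
move=> evenF; apply: (big_ind (fun n => ~~ odd n)) => // a b.
by rewrite oddD => /negPf -> /negPf ->.
Qed.

(** * Parity count with slack vertices *)

Section Scarf.
Variables (I T : finType) (r : I -> T -> nat) (c : T -> I) (i0 : I) (t0 : T).
Hypothesis r_inj : forall i, injective (r i).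

(** The successor on [T] leaves 0 free for the slack vertex of the order [i], and [enum_rank]
    separates the other slack vertices, so that keys stay injective. *)
Let slack_key i (v : T + I) :=
  match v with
  | inl t => (r i t).+1
  | inr j => if j == i then 0 else (\max_t r i t).+2 + enum_rank j
  end.

Let slack_color (v : T + I) := match v with inl t => c t | inr j => j end.

Let slack_key_inj i : injective (slack_key i).
Proof.
have le_max t : r i t <= \max_t r i t by exact: (leq_bigmax (F := r i)).
case=> [t|j] [t'|j'] /=.
- by case=> /r_inj ->.
- by case: eqP => // _; have := le_max t; lia.
- by case: eqP => // _; have := le_max t'; lia.
case: eqVneq => [->|ji]; case: eqVneq => [->|ji'] //.
by move/addnI/ord_inj/enum_rank_inj->.
Qed.

Let outer_door : {set T + I} := inr @: ~: [set i0].

Let card_outer_door : #|outer_door|.+1 = #|I|.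
Proof.
rewrite card_imset; last by move=> ? ? [].
by rewrite cardsC1 prednK //; apply/card_gt0P; exists i0.
Qed.

(** For [i != i0] the slack vertex [i] has key 0, so only the order [i0] can place a vertex of [T]
    below the whole set; the added vertex must then be the greatest one for [i0]. *)
Let outer_completions :
  [set x | (x \notin outer_door) && dominant slack_key (x |: outer_door)] =
  [set inl [arg max_(t > t0) r i0 t]].
Proof.
case: arg_maxnP => // tm _ tmax.
have tmP x : r i0 x <= r i0 tm by exact: tmax.
apply/setP => -[t|j]; rewrite !inE.
  rewrite (_ : inl t \in outer_door = false) /=; last first.
    by apply/negbTE/negP => /imsetP[].
  apply/idP/eqP => [/dominantP/(_ (inl tm))[i tm_le]|[->]].
    have [ii0|ii0] := eqVneq i i0; last first.
      have /tm_le : inr i \in inl t |: outer_door.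
        by rewrite !inE mem_imset ?inE ?ii0 ?orbT // => ? ? [].
      by rewrite /= eqxx.
    have /tm_le := setU11 (inl t) outer_door.
    rewrite ii0 /= ltnS => tmt; congr inl; apply: (r_inj (i := i0)).
    by apply/eqP; rewrite eqn_leq tmt tmP.
  apply/dominantP => -[t'|j].
    exists i0 => x; rewrite in_setU1 => /predU1P[->|/imsetP[j]].
      by rewrite /= ltnS tmP.
    rewrite !inE => jio -> /=; rewrite (negPf jio).
    by have := leq_bigmax (F := r i0) t'; lia.
  by exists j => x _; rewrite /= eqxx.
rewrite [RHS]/=; apply/negbTE/negP => /andP[jd].
have ji0 : j = i0.
  apply/eqP; apply: contraR jd => ji0.
  by apply: imset_f; rewrite !inE.
move=> /dominantP/(_ (inl tm))[i tm_le].
suff /tm_le : inr i \in inr j |: outer_door by rewrite /= eqxx.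
rewrite in_setU1 ji0; have [->|ii0] := eqVneq i i0; first by rewrite eqxx.
by apply/orP; right; apply: imset_f; rewrite !inE.
Qed.

(* The elements [inr j] are slack vertices: minimal for the order [j] and above
   all of [T] for the other ones. With them, doors and rooms become the
   dominant sets of cardinality [#|I| - 1] and [#|I|], related by inclusion, and
   Sperner's parity count applies. *)
Lemma scarf_rainbow :
  exists S : {set T}, forall y,
    exists2 i, i \in c @: S & {in S, forall x, r i y <= r i x}.
Proof.
have [p /andP[domp /eqP cp]|norainbow] :=
  pickP (fun p : {set T + I} => dominant slack_key p && (slack_color @: p == setT)).
  exists [set t | inl t \in p] => y.
  have [i yp] := elimT (dominantP _ _) domp (inl y).
  exists i; last by move=> x; rewrite inE => /yp.
  (* The colour [i] cannot come from a slack vertex of [p]: its key 0 for the order [i] is below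
     that of [inl y]. *)
  have /imsetP[[t tp ->|j jp ij]] : i \in slack_color @: p by rewrite cp inE.
    by apply: imset_f; rewrite inE.
  by move: ij => /= ij; have := yp _ jp; rewrite /= ij eqxx.
(* [P] and [Q] describe the same incidences of a door, coloured by all but [i0], with a room: [P]
   marks the door and the added vertex, [Q] the room and the removed one. *)
pose P (d : {set T + I}) x := [&& x \notin d, #|d|.+1 == #|I|,
  dominant slack_key (x |: d) & slack_color @: d == ~: [set i0]].
pose Q (p : {set T + I}) x := [&& x \in p, #|p| == #|I|,
  dominant slack_key p & slack_color @: (p :\ x) == ~: [set i0]].
have sum_bool (p : pred (T + I)) : \sum_x (p x : nat) = #|[set x | p x]|.
  by rewrite -sum1dep_card [RHS]big_mkcond; apply: eq_bigr => x _; case: (p x).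
have PQ : \sum_d \sum_x (P d x : nat) = \sum_p \sum_x (Q p x : nat).
  rewrite exchange_big [RHS]exchange_big /=; apply: eq_bigr => x _.
  pose toggle (d : {set T + I}) := if x \in d then d :\ x else x |: d.
  have toggleK : involutive toggle.
    move=> d; rewrite /toggle; case: (boolP (x \in d)) => xd.
      by rewrite setD11 setD1K.
    by rewrite setU11 setU1K.
  rewrite [RHS](reindex_inj (inv_inj toggleK)); apply: eq_bigr => d _.
  rewrite /P /Q /toggle; case: ifP => xd; first by rewrite !inE eqxx.
  by rewrite setU11 cardsU1 xd add1n setU1K ?xd.
have even_Q : ~~ odd (\sum_p \sum_x (Q p x : nat)).
  apply: even_sum => p _; rewrite sum_bool.
  have [cardp|cardp] := eqVneq #|p| #|I|; last first.
    rewrite (_ : finset _ = set0) ?cards0 //; apply/setP => x.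
    by rewrite !inE /Q (negPf cardp) !andbF.
  have [domp|domp] := boolP (dominant slack_key p); last first.
    rewrite (_ : finset _ = set0) ?cards0 //; apply/setP => x.
    by rewrite !inE /Q (negPf domp) !andbF.
  rewrite (_ : finset _ = [set x in p | slack_color @: (p :\ x) == ~: [set i0]]).
    by apply: even_facets => //; have /= := norainbow p; rewrite domp /= => ->.
  by apply/setP => x; rewrite !inE /Q cardp eqxx domp.
(* The outer door contributes one incidence and every other door an even number. *)
have : odd (\sum_d \sum_x (P d x : nat)); last by rewrite PQ (negPf even_Q).
rewrite (bigD1 outer_door) //= oddD sum_bool.
rewrite (_ : finset _ =
    [set x | (x \notin outer_door) && dominant slack_key (x |: outer_door)]); last first.
  apply/setP => x; rewrite !inE /P card_outer_door eqxx /= -imset_comp.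
  by rewrite (eq_imset (g := id)) // imset_id eqxx andbT.
rewrite outer_completions cards1 /=; apply: even_sum => d d_out; rewrite sum_bool.
have [/andP[/eqP cardd /eqP cd]|dP] :=
    boolP ((#|d|.+1 == #|I|) && (slack_color @: d == ~: [set i0])); last first.
  rewrite (_ : finset _ = set0) ?cards0 //; apply/setP => x.
  rewrite !inE /P; apply: contraNF dP => /and4P[_ -> _ ->] //.
have [domd|domd] := boolP (dominant slack_key d); last first.
  rewrite (_ : finset _ = set0) ?cards0 //; apply/setP => x.
  rewrite !inE /P; apply: contraNF domd => /and4P[_ _ + _].
  exact/dominantS/subsetUr.
rewrite (_ : finset _ =
    [set x | (x \notin d) && dominant slack_key (x |: d)]); last first.
  by apply/setP => x; rewrite !inE /P cardd cd !eqxx andbT.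
(* A door of slack vertices alone is the outer one, by its colours. Any other door meets [T], and
   the slack vertex [k] exceeds an element of [T] in every order but [k]. *)
have [t td] : exists t, inl t \in d.
  apply/existsP; apply: contraR d_out; rewrite negb_exists => /forallP no_inl.
  rewrite eqEcard -ltnS cardd card_outer_door leqnn andbT.
  apply/subsetP => -[t td|j jd]; first by have := no_inl t; rewrite td.
  by apply: imset_f; rewrite -cd; apply/imsetP; exists (inr j).
apply: even_completions => //; first by apply/set0Pn; exists (inl t).
move=> k; exists (inr k) => l lk; exists (inl t) => //=.
by rewrite eq_sym (negPf lk); have := leq_bigmax (F := r l) t; lia.
Qed.
End Scarf.

(** By Scarf's lemma no grid point lies strictly above the coordinatewise minimum of [S] at all
    colours of [S]. Hence this minimum, set to 0 at the other coordinates, has sum at least [N - n];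
    topping it up at a colour of [S] gives [z]. *)
Lemma grid_sperner (n N : nat) (c : {ffun 'I_n -> nat} -> 'I_n) :
  exists2 z : {ffun 'I_n -> nat}, \sum_i z i = N &
    forall i, z i != 0 -> exists x : {ffun 'I_n -> nat},
      [/\ \sum_j x j = N, c x = i & forall j, x j <= z j + n /\ z j <= x j + n].
Proof.
pose sumN (t : {ffun 'I_n -> 'I_N.+1}) := \sum_i (t i : nat) == N.
pose T := {t | sumN t}.
pose g (t : T) : {ffun 'I_n -> nat} := [ffun i => val t i : nat].
have sum_g t : \sum_i g t i = N.
  by rewrite -[RHS](eqP (valP t)); apply: eq_bigr => i _; rewrite ffunE.
have g_surj (x : {ffun 'I_n -> nat}) : \sum_i x i = N -> exists t, g t = x.
  move=> sumx; have xN i : x i < N.+1 by rewrite ltnS -sumx (bigD1 i) //= leq_addr.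
  have tP : sumN [ffun i => Ordinal (xN i)].
    by rewrite /sumN -[X in _ == X]sumx; apply/eqP/eq_bigr => i _; rewrite ffunE.
  exists (exist (fun t => is_true (sumN t)) _ tP).
  by apply/ffunP => i; rewrite /g !ffunE /= ?ffunE.
have sum_at (h : 'I_n -> nat) (i : 'I_n) (k : nat) :
    \sum_j (h j + (if j == i then k else 0)) = \sum_j h j + k.
  by rewrite big_split -big_mkcond big_pred1_eq.
pose i0 := c [ffun => 0].
have [t0 _] : exists t, g t = [ffun j => 0 + (if j == i0 then N else 0)].
  apply: g_surj; under eq_bigr do rewrite ffunE.
  by rewrite sum_at big1.
(* Ties between equal coordinates are broken by the rank in [T]. *)
pose r i (t : T) := g t i * #|{: T}| + enum_rank t.
have r_inj i : injective (r i).
  move=> t t' /(congr1 (modn^~ #|{: T}|)).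
  by rewrite /r !modnMDl !modn_small // => /ord_inj/enum_rank_inj.
have r_le i t t' : r i t <= r i t' -> g t i <= g t' i.
  rewrite leqNgt => ltr; rewrite leqNgt; apply: contra ltr => ltg.
  have lek : g t' i * #|{: T}| + #|{: T}| <= g t i * #|{: T}|.
    by rewrite addnC -mulSn leq_mul2r ltg orbT.
  by rewrite /r (leq_trans _ (leq_addr _ _)) // (leq_trans _ lek) // -addnS leq_add2l.
have [S SP] := scarf_rainbow (c \o g) i0 t0 r_inj.
have [i1 i1J _] := SP t0; pose J := (c \o g) @: S; rewrite -/J in i1J.
have [s0 s0S _] := imsetP i1J.
pose w i := if i \in J then g [arg min_(s < s0 in S) g s i] i else 0.
have w_le s i : s \in S -> w i <= g s i.
  by rewrite /w; case: ifP => // _ sS; case: arg_minnP => // s' _; apply.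
have w_sum : \sum_i w i <= N.
  by rewrite -(sum_g s0); apply: leq_sum => i _; apply: w_le.
have w_large : N <= \sum_i w i + n.
  rewrite leqNgt; apply/negP => small.
  have sumS : \sum_i (w i + (i \in J : nat)) <= N.
    rewrite big_split /= (leq_trans _ (ltnW small)) // leq_add2l.
    rewrite -[X in _ <= X]card_ord -sum1_card; apply: leq_sum => i _.
    exact: leq_b1.
  (* Raising [w] by one on [J], with the remainder put at [i1], would give a forbidden grid
     point. *)
  have [t tE] : exists t, g t = [ffun j => w j + (j \in J : nat) +
      (if j == i1 then N - \sum_i (w i + (i \in J : nat)) else 0)].
    by apply: g_surj; under eq_bigr do rewrite ffunE; rewrite sum_at; lia.
  have [i iJ tmin] := SP t; rewrite -/J in iJ.
  suff : g t i <= w i by rewrite tE ffunE iJ; lia.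
  rewrite /w iJ; case: arg_minnP => // s sS _; exact/r_le/tmin.
pose z := [ffun j => w j + (if j == i1 then N - \sum_i w i else 0)].
have zE j : z j = w j + (if j == i1 then N - \sum_i w i else 0) by rewrite ffunE.
exists z; first by under eq_bigr do rewrite zE; rewrite sum_at subnKC.
move=> i; rewrite zE => zi.
have /imsetP[s sS iE] : i \in J.
  apply: contraR zi => iJ; rewrite /w (negPf iJ).
  by case: (eqVneq i i1) iJ => [->|] //; rewrite i1J.
exists (g s); split => // j; rewrite zE.
(* Since [w] is below [g s] everywhere, one coordinate gap is at most the sum of all gaps. *)
have gap : g s j - w j <= N - \sum_i w i.
  rewrite -(sum_g s) (bigD1 j) //= [\sum_i w i](bigD1 j) //=.
  rewrite subnDA -addnBAC ?w_le // -addnBA ?leq_addr //.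
  by apply: leq_sum => l _; apply: w_le.
by have := w_le s j sS; case: ifP => _; lia.
Qed.

End Combinatorics.

Local Open Scope classical_set_scope.
Local Open Scope ring_scope.

(** * The KKM theorem *)

Definition weights (R : realType) (n : nat) (l : 'I_n -> R) : Prop :=
  (forall i, 0 <= l i) /\ \sum_i l i = 1.

Lemma weights_neq0 (R : realType) (n : nat) (l : 'I_n -> R) :
  weights l -> exists i, l i != 0.
Proof.
case=> _ suml; apply/existsP; apply: contraT => /existsPn l0.
have := oner_neq0 R; rewrite -suml big1 ?eqxx // => i _.
by apply/eqP/negPn/l0.
Qed.

Section TopologicalVectorSpace.
Variables (R : realType) (X : tvsType R).

Lemma cvg_scale (T : Type) (F : set_system T) (FF : Filter F)
    (s : T -> R^o) (g : T -> X) (a : R^o) (x : X) :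
  s @ F --> a -> g @ F --> x -> (fun t => s t *: g t) @ F --> a *: x.
Proof.
move=> sa gx; apply: (@cvg_comp _ _ _ (fun t => (s t, g t))
  (fun z : R^o * X => z.1 *: z.2) F _ _ (cvg_pair sa gx)).
exact: (@scale_continuous R X (a, x)).
Qed.

Lemma continuous_combination (n : nat) (y : 'I_n -> X) :
  continuous (fun l : 'rV[R]_n => \sum_i l ord0 i *: y i).
Proof.
move=> l; apply: (cvg_big (@add_continuous X) (nbhs_filter l)) => i _.
apply: (cvg_scale (nbhs_filter l)); [exact: coord_continuous | exact: cvg_cst].
Qed.

Lemma continuous_affine (a : X) (t : R) : continuous (fun x : X => a + t *: x).
Proof.
move=> x; apply: (@cvg_comp _ _ _ (fun x : X => (a, t *: x))
  (fun z : X * X => z.1 + z.2) (nbhs x) (nbhs (a, t *: x))).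
  apply: cvg_pair; first exact: cvg_cst.
  by apply: (cvg_scale (nbhs_filter x)); [exact: cvg_cst | exact: cvg_id].
exact: (@add_continuous X (a, t *: x)).
Qed.

(** The argument runs on weight vectors, so [y] may have repetitions or affine dependences. *)
Lemma kkm (n : nat) (y : 'I_n -> X) (G : 'I_n -> set X) :
  (forall i, closed (G i)) ->
  (forall l, weights l -> exists2 i, l i != 0 & G i (\sum_j l j *: y j)) ->
  exists x, forall i, G i x.
Proof.
move=> clG coverG; case: n => [|n] in y G clG coverG *; first by exists 0 => -[].
apply: contrapT => noG.
pose phi (l : 'rV[R]_n.+1) := \sum_i l ord0 i *: y i.
pose simplex : set 'rV[R]_n.+1 :=
  [set l | forall i, `[0, 1]%classic (l ord0 i)] `&` [set l | \sum_i l ord0 i = 1].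
have simplexP (l : 'rV[R]_n.+1) :
    (forall i, 0 <= l ord0 i) -> \sum_i l ord0 i = 1 -> simplex l.
  move=> l0 suml; split => // i; rewrite /= in_itv /= l0 /= -suml (bigD1 i) //=.
  by rewrite lerDl sumr_ge0.
have compact_simplex : compact simplex.
  apply: compact_closedI; first exact: (rV_compact (fun=> @segment_compact R 0 1)).
  apply: (@closed_comp _ _ (fun l : 'rV[R]_n.+1 => \sum_i l ord0 i) [set 1]).
    move=> l _; apply: (cvg_big (@add_continuous R^o) (nbhs_filter l)) => i _.
    exact: coord_continuous.
  exact: closed_eq.
(* Lebesgue number of the open cover by the complements of the [G i]. *)
pose uniform e l := exists i, forall l', ball l e l' -> ~ G i (phi l').
have [e [e0 eP]] : exists e : R, 0 < e /\ simplex `<=` uniform e.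
  suff : \forall e \near (0 : R)^'+, 0 < e /\ simplex `<=` uniform e.
    exact: (@filter_ex _ _ (at_right_proper_filter 0)).
  apply: filterI; first exact: nbhs_right_gt.
  apply: ((compact_near_coveringP _).1 compact_simplex R (0 : R)^'+ uniform) => l _.
  have [i Gil] : exists i, ~ G i (phi l).
    by apply/existsNP => Gl; apply: noG; exists (phi l).
  have : nbhs l (phi @^-1` ~` G i).
    apply: continuous_combination; apply: open_nbhs_nbhs; split => //.
    exact/closed_openC/clG.
  move/nbhs_ballP => [d /= d0 dP].
  exists (ball l (d / 2), [set e | e < d / 2]).
    split; first by apply: nbhsx_ballx; rewrite divr_gt0.
    by apply: nbhs_right_lt; rewrite divr_gt0.
  case=> l' e [/= ll' ed]; exists i => l'' l'l''; apply: dP.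
  by apply: (ball_split ll'); apply: le_ball l'l''; exact: ltW.
(* Integer coordinates differing by at most [n.+1] differ by less than [e] after division by [N]. *)
pose N := Num.bound (n.+1%:R / e).
have N0 : 0 < N%:R :> R.
  apply: le_lt_trans (archi_boundP _); by rewrite divr_ge0 // ltW.
pose vec (x : {ffun 'I_n.+1 -> nat}) : 'rV[R]_n.+1 := \row_i ((x i)%:R / N%:R).
have sum_vec (x : {ffun 'I_n.+1 -> nat}) :
    (\sum_i x i)%N = N -> \sum_i vec x ord0 i = 1.
  move=> sumx; under eq_bigr do rewrite mxE.
  by rewrite -mulr_suml -natr_sum sumx divff // gt_eqF.
have vec_ge0 x i : 0 <= vec x ord0 i by rewrite mxE divr_ge0.
(* Off the grid, [ord0] is a dummy colour. *)
have /choice[c cP] : forall x : {ffun 'I_n.+1 -> nat}, exists i,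
    (\sum_j x j)%N = N -> forall l', ball (vec x) e l' -> ~ G i (phi l').
  move=> x; have [/eqP sumx|sumx] := boolP ((\sum_i x i)%N == N).
    have [i iP] := eP _ (simplexP _ (vec_ge0 x) (sum_vec _ sumx)).
    by exists i => _; apply: iP.
  by exists ord0 => /eqP; rewrite (negPf sumx).
have [z sumz zP] := grid_sperner N c.
have [i zi Gi] := coverG (fun i => vec z ord0 i) (conj (vec_ge0 z) (sum_vec _ sumz)).
have [|x [sumx cx close]] := zP i.
  by apply: contraNneq zi => zi; rewrite mxE zi mul0r.
apply: (cP _ sumx (vec z)); last by rewrite cx.
split=> // a j; rewrite ord1 -ball_normE /= !mxE -mulrBl normrM normfV (gtr0_norm N0).
rewrite ltr_pdivrMr // (@le_lt_trans _ _ n.+1%:R) //.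
  have [xz zx] := close j.
  by rewrite ler_distl lerBlDr -!natrD !ler_nat zx xz.
by rewrite mulrC -ltr_pdivrMr // archi_boundP // divr_ge0 // ltW.
Qed.

End TopologicalVectorSpace.

(** * The vector equilibrium problem *)

(** Induction on the number of nonzero weights: one vertex is split off, the normalized remainder is
    approximated by a point of [D], and density of [D] in the segment from the vertex to that point
    concludes. *)
Lemma dense_combination (R : realType) (X : tvsType R) (D : set X) (n : nat)
    (y : 'I_n -> X) (l : 'I_n -> R) (W : set X) :
  (forall x x', D x -> D x' -> segment x x' `<=` closure (segment x x' `&` D)) ->
  (forall i, D (y i)) -> weights l -> nbhs (\sum_i l i *: y i) W ->
  exists m, [/\ weights m, forall i, l i = 0 -> m i = 0,
    D (\sum_i m i *: y i) & W (\sum_i m i *: y i)].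
Proof.
move=> segD Dy; have [k] := ubnP #|[pred i | l i != 0]|.
elim: k l W => // k IHk l W supp_l wl lW; have [l_ge0 suml] := wl.
have [i li0] := weights_neq0 wl.
have sumD1 : l i + \sum_(j | j != i) l j = 1 by rewrite -suml [RHS](bigD1 i).
have [li1|li1] := eqVneq (l i) 1.
  have l0 j : j != i -> l j = 0.
    have /psumr_eq0P : \sum_(j | j != i) l j = 0.
      by apply: (addrI (l i)); rewrite sumD1 addr0.
    by apply.
  exists l; split=> //; last exact: nbhs_singleton.
  by rewrite (bigD1 i) //= li1 scale1r big1 ?addr0 // => j /l0 ->; rewrite scale0r.
have rest : \sum_(j | j != i) l j = 1 - l i.
  by apply/eqP; rewrite eq_sym subr_eq addrC sumD1.
have li_lt1 : 0 < 1 - l i.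
  rewrite lt_def subr_eq0 eq_sym li1 subr_ge0 -sumD1 lerDl.
  by apply: sumr_ge0.
pose l' j := if j == i then 0 else l j / (1 - l i).
have wl' : weights l'.
  split=> [j|].
    by rewrite /l'; case: ifP => // _; rewrite divr_ge0 // ltW.
  rewrite (bigD1 i) //= /l' eqxx add0r.
  under eq_bigr => j ji do rewrite (negPf ji).
  by rewrite -mulr_suml rest divff // gt_eqF.
have lE : \sum_j l j *: y j = l i *: y i + (1 - l i) *: \sum_j l' j *: y j.
  rewrite (bigD1 i) //= [in RHS](bigD1 i) //= /l' eqxx scale0r add0r scaler_sumr.
  congr (_ + _); apply: eq_bigr => j ji.
  by rewrite (negPf ji) scalerA mulrCA divff ?mulr1 // gt_eqF.
have supp_l' : (#|[pred j | l' j != 0%R]| < k)%N.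
  rewrite -ltnS; apply: leq_trans supp_l; rewrite ltnS.
  apply: proper_card; apply/properP; split.
    apply/fintype.subsetP => j; rewrite !inE /l'; case: ifP; rewrite ?eqxx //.
    by move=> _; apply: contra_neq => ->; rewrite mul0r.
  by exists i; rewrite !inE /l' ?eqxx.
rewrite lE in lW.
(* Using the interior makes [W] a neighbourhood of the new point of the segment, as needed to
   approximate that point within [D]. *)
have l'W : nbhs (\sum_j l' j *: y j)
    ((fun x => l i *: y i + (1 - l i) *: x) @^-1` W°).
  exact/continuous_affine/nbhs_interior.
have [m' [[m'_ge0 summ'] l'm' Dm' Wm']] := IHk _ _ supp_l' wl' l'W.
set x := \sum_j m' j *: y j in Dm' Wm'.
have on_segment : segment (y i) x (l i *: y i + (1 - l i) *: x).
  exists (1 - l i); last first.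
    by rewrite scalerBr addrCA -{1}[y i]scale1r -scalerBl subKr addrC.
  by rewrite /= in_itv /= (ltW li_lt1) gerBl l_ge0.
have [_ [[[t t01 <-] Dp] Wp]] := segD _ _ (Dy i) Dm' _ on_segment _ Wm'.
exists (fun j => (if j == i then 1 - t else 0) + t * m' j).
have -> : \sum_j ((if j == i then 1 - t else 0) + t * m' j) *: y j =
    y i + t *: (x - y i).
  under eq_bigr do rewrite scalerDl -scalerA.
  rewrite big_split -scaler_sumr /= -/x (bigD1 i) //= eqxx big1 ?addr0.
    by rewrite scalerBl scalerBr scale1r addrAC addrA.
  by move=> j /negPf ->; rewrite scale0r.
move: t01; rewrite /= in_itv /= => /andP[t_ge0 t_le1].
split=> //; last first.
  move=> j lj0; have ji : j != i by apply: contraNneq li0 => <-; apply/eqP.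
  by rewrite (negPf ji) l'm' ?mulr0 ?addr0 // /l' (negPf ji) lj0 mul0r.
split=> [j|].
  by rewrite addr_ge0 ?mulr_ge0 //; case: ifP => // _; rewrite subr_ge0.
rewrite big_split -mulr_sumr summ' (bigD1 i) //= eqxx big1 ?addr0 ?mulr1 ?subrK //.
by move=> j /negPf ->.
Qed.

(** * Stability of [- int C] *)

Section Cone.
Variables (R : realType) (Z : tvsType R) (C : set Z).
Hypotheses (coneC : cone C) (convC : convex_cone C).

Lemma convex_coneD a b : C a -> C b -> C (a + b).
Proof. by move=> Ca Cb; rewrite -convC; exists a => //; exists b. Qed.

Lemma opp_intE z : opp_int C z <-> C° (- z).
Proof.
split=> [[c Cc <-]|Cz]; first by rewrite opprK.
by exists (- z) => //; rewrite opprK.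
Qed.

Lemma interior_coneD a b : C° a -> C b -> C° (a + b).
Proof.
move=> Ca Cb.
have /(continuous_affine (a := - b) (t := 1)) : nbhs (- b + 1 *: (a + b)) C.
  by rewrite scale1r addrC addrK.
apply: (@filterS _ (nbhs (a + b))) => x /= Cx; have := convex_coneD Cb Cx.
by rewrite scale1r addNKr.
Qed.

Lemma interior_coneZ t a : 0 < t -> C° a -> C° (t *: a).
Proof.
move=> t0 Ca.
have /(continuous_affine (a := 0) (t := t^-1)) : nbhs (0 + t^-1 *: (t *: a)) C.
  by rewrite add0r scalerA mulVf ?scale1r // gt_eqF.
apply: (@filterS _ (nbhs (t *: a))) => x /= Cx; have := coneC Cx (ltW t0).
by rewrite add0r scalerA mulfV ?scale1r // gt_eqF.
Qed.

Lemma opp_int_nbhs z : opp_int C z -> nbhs z (opp_int C).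
Proof.
move=> /opp_intE /nbhs_interior.
rewrite -[- z]add0r -scaleN1r => /continuous_affine.
by apply: (@filterS _ (nbhs z)) => x; rewrite /= add0r scaleN1r => /opp_intE.
Qed.

Lemma opp_intB z c : opp_int C z -> C c -> opp_int C (z - c).
Proof.
move=> /opp_intE Cz Cc; apply/opp_intE; rewrite opprB addrC.
exact: interior_coneD.
Qed.

(** Some weight is nonzero, which gives one term in [- int C]; the other terms lie in [- C], and
    adding them does not leave [- int C]. *)
Lemma opp_int_combination (n : nat) (m : 'I_n -> R) (g : 'I_n -> Z) :
  weights m -> (forall i, m i != 0 -> opp_int C (g i)) ->
  opp_int C (\sum_i m i *: g i).
Proof.
move=> wm gC; have [i mi0] := weights_neq0 wm; have [m_ge0 _] := wm.
have Cg j : m j != 0 -> C° (m j *: - g j).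
  by move=> mj0; apply: interior_coneZ; [rewrite lt_def mj0 m_ge0 | apply/opp_intE/gC].
have C0 : C 0.
  by have := coneC (interior_subset (Cg _ mi0)) (lexx 0); rewrite scale0r.
apply/opp_intE; rewrite -sumrN (bigD1 i) //= -scalerN; apply: interior_coneD.
  exact: Cg.
apply: big_ind => // [|j _]; first exact: convex_coneD.
rewrite -scalerN; have [->|mj0] := eqVneq (m j) 0; first by rewrite scale0r.
exact: (interior_subset (Cg _ mj0)).
Qed.

(** [- int C] is a neighbourhood of [g x], and it is stable under subtraction of elements of [C]. *)
Lemma usc_opp_int (X : tvsType R) (K : set X) (g : X -> Z) (x : X) :
  cone_usc_at C K g x -> opp_int C (g x) ->
  \forall u \near x, K u -> opp_int C (g u).
Proof.
move=> usc /opp_int_nbhs/usc[U xU gU].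
apply: filterS xU => u Uu Ku; have [v Cv [c Cc <-]] := gU _ (conj Uu Ku).
exact: opp_intB.
Qed.

End Cone.

Theorem theorem3p3 (R : realType) (X Z : tvsType R)
    (hX : hausdorff_space X) (hZ : hausdorff_space Z)
    (C : set Z) (coneC : cone C) (convC : convex_cone C)
    (pointedC : pointed_cone C) (intC : C° !=set0)
    (K : set X) (K_neq0 : K !=set0) (convK : convex_set K) (clK : closed K)
    (D : set X) (DK : D `<=` K) (ssdD : self_segment_dense D K)
    (f : X -> X -> Z)
    (f_i : forall y, D y -> cone_usc_on C K K (fun x => f x y))
    (f_ii : forall x, K x -> cone_usc_on C K (K `\` D) (fun y => f x y))
    (f_iii : forall x, D x -> cone_convex_on C D (fun y => f x y))
    (f_iv : forall x, D x -> ~ opp_int C (f x x))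
    (f_v : exists (K0 : set X) (y0 : X),
       [/\ compact K0, D y0 &
           forall x, (K `\` K0) x -> opp_int C (f x y0)]) :
  exists2 x0, K x0 & forall y, K y -> ~ opp_int C (f x0 y).

Proof.
have [[_ KclD] segD] := ssdD; have [K0 [y0 [K0_compact Dy0 outside_K0]]] := f_v.
pose G y := K `&` [set x | ~ opp_int C (f x y)].
have clG y : D y -> closed (G y).
  move=> Dy; rewrite -openC openE => x Gx.
  have [Kx|nKx] := pselect (K x); last first.
    have : nbhs x (~` K) by apply: open_nbhs_nbhs; split => //; exact: closed_openC.
    by apply: (@filterS _ (nbhs x)) => u nKu [].
  have fxy : opp_int C (f x y) by apply: contrapT => nfxy; apply: Gx.
  apply: (@filterS _ (nbhs x) _ _ _ _ (usc_opp_int convC (f_i _ Dy _ Kx) fxy)).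
  by move=> u uC [Ku]; apply; exact: uC.
have coverG n (y : 'I_n -> X) : (forall i, D (y i)) ->
    exists x, forall i, G (y i) x.
  move=> Dy; apply: (kkm (y := y)) => [i|l wl]; first exact: clG.
  apply: contrapT => noG.
  (* Finitely many closed sets are avoided at the combination, hence also at a nearby combination
     lying in [D]. *)
  have near_noG : \forall x \near \sum_i l i *: y i,
      forall i, l i != 0 -> ~ G (y i) x.
    apply: (filter_forall (nbhs_filter _)) => i.
    have [li0|li0] := eqVneq (l i) 0.
      by apply: (@filterE _ (nbhs _)).
    have : nbhs (\sum_i l i *: y i) (~` G (y i)).
      apply: open_nbhs_nbhs; split; first exact/closed_openC/clG.
      by move=> Gx; apply: noG; exists i.
    by apply: (@filterS _ (nbhs _)) => x nGx _.
  have [m [wm lm Dm noGm]] :=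
    dense_combination (fun x x' Dx Dx' => (segD x x' Dx Dx').2) Dy wl near_noG.
  set x := \sum_i m i *: y i in Dm noGm.
  have fxy i : m i != 0 -> opp_int C (f x (y i)).
    move=> mi0; apply: contrapT => nfxy.
    by apply: (noGm i); [apply: contra_neq mi0; exact: lm | split=> //; exact: DK].
  apply: (f_iv _ Dm).
  (* Convexity bounds [f x x] by a combination lying in [- int C], which contradicts (iv). *)
  have := f_iii _ Dm _ _ _ Dy wm.1 wm.2 Dm; rewrite -/x => fx_le.
  by have := opp_intB convC (opp_int_combination coneC convC wm fxy) fx_le; rewrite subKr.
(* The filter generated by [K] and the [G y] with [y] in [D]; its properness is the finite
   intersection property. *)
pose F := [set A | exists2 s : seq X, {in s, forall y, D y} &
  K `&` [set x | {in s, forall y, G y x}] `<=` A].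
have FG y : D y -> F (G y).
  move=> Dy; exists [:: y] => [z|x [_ xG]]; first by rewrite inE => /eqP ->.
  by apply: xG; rewrite inE.
have F_proper : ProperFilter F.
  split; last split.
  (* Prepending [y0] places the common point in [K] even when [s] is empty. *)
  - move=> [s sD]; have [i|x xG] := coverG _ (tnth (in_tuple (y0 :: s))).
      by have := mem_tnth i (in_tuple (y0 :: s)); rewrite inE => /predU1P[->|/sD].
    have xGs y : y \in y0 :: s -> G y x by move=> /seq_tnthP[i ->]; exact: xG.
    move=> /(_ x); apply; split; first by case: (xGs y0 (mem_head _ _)).
    by move=> y ys; apply: xGs; rewrite inE ys orbT.
  - by exists [::].
  - move=> A B [s sD sA] [s' s'D s'B]; exists (s ++ s').
      by move=> y; rewrite mem_cat => /orP[/sD|/s'D].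
    move=> x [Kx xG]; split; [apply: sA | apply: s'B]; split=> // y ys;
      by apply: xG; rewrite mem_cat ys ?orbT.
  - by move=> A B AB [s sD sA]; exists s => //; apply: subset_trans AB.
(* [G y0] is a closed subset of the compact set [K0], so [F] clusters in it; each [G y], being
   closed, contains the cluster point. *)
have [x [[Kx _] xF]] : exists x, (G y0 `&` cluster F) x.
  apply: (subclosed_compact (clG _ Dy0) K0_compact _ F_proper (FG _ Dy0)).
  by move=> x [Kx nfx]; apply: contrapT => nK0x; exact/nfx/outside_K0.
have xG y : D y -> G y x.
  by move=> Dy; apply: (clG _ Dy) => B xB; apply: xF => //; exact: FG.
exists x => // y Ky fxy.
have [Dy|nDy] := pselect (D y); first by have [] := xG _ Dy.
(* By (ii), [f x] stays in [- int C] at points of [K] near [y]; density supplies one in [D], where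
   [xG] forbids it. *)
have [y' [Dy' fxy']] := KclD _ Ky _ (usc_opp_int convC (f_ii _ Kx _ (conj Ky nDy)) fxy).
have [_] := xG _ Dy'; apply; exact/fxy'/DK.
Qed.
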